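(* Let $X$ be a real vector space, $\mathcal{D}\subset X$ a nonempty convex set whose linear span is $X$, and $\mathcal{V}$ a real vector space with a nondegenerate bilinear pairing $\langle\cdot,\cdot\rangle:\mathcal{V}\times X\to\mathbb{R}$. Let $F,F_0:\mathcal{D}\to\mathbb{R}$ be convex functions bounded below, and let $\Phi=F-F_0$; extend $F,F_0,\Phi$ to $X$ by the value $+\infty$ off $\mathcal{D}$. Let $E,\Delta,\mathcal{Z}$ (constructed from $F$), $E_0,\Delta_0,\mathcal{Z}_0$ (constructed from $F_0$) and the lower semiderivative $\underline{\mathsf D}\Phi$ be as defined in the context. Let $v^{\odot}\in\mathcal{V}$ (the target potential) and $v_0\in\mathcal{V}$. Suppose $\rho_0\in\mathcal{D}$ satisfies $(v_0,\rho_0)\in\mathcal{Z}_0$, let $w_0\in\underline{\mathsf D}\Phi(\rho_0)$, and put $\widehat{v_0}=v_0-w_0$ and $R=v^{\odot}-\widehat{v_0}$. Let $\lambda>0$ and $v_\lambda=v_0+\lambda R$. Suppose $\rho_\lambda\in\mathcal{D}$ satisfies $(v_\lambda,\rho_\lambda)\in\mathcal{Z}_0$, let $w_\lambda\in\underline{\mathsf D}\Phi(\rho_\lambda)$, and put $\widehat{v_\lambda}=v_\lambda-w_\lambda$. Define $$\mathrm{inc}(v^{\odot};\rho_\lambda,\rho_0)=F(\rho_\lambda)-F(\rho_0)+\langle v^{\odot},\rho_\lambda-\rho_0\rangle .$$ Then $$\mathrm{inc}(v^{\odot};\rho_\lambda,\rho_0)=\Delta(\widehat{v_0},\rho_\lambda)-\frac1\lambda\Big[\Delta_0(v_\lambda,\rho_0)+\Delta_0(v_0,\rho_\lambda)\Big],$$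 and this quantity is bounded above by each of the following two expressions: $$\lambda^{-1}\langle v_\lambda-v_0,\rho_\lambda-\rho_0\rangle-\langle\widehat{v_\lambda}-\widehat{v_0},\rho_\lambda-\rho_0\rangle,$$ $$\big\langle(1-\lambda)R-w_0+w_\lambda,\ \rho_\lambda-\rho_0\big\rangle .$$
   Context: For $v\in\mathcal{V}$ and $\rho\in\mathcal{D}$: $E(v)=\inf\{F(\rho')+\langle v,\rho'\rangle:\rho'\in\mathcal{D}\}\in[-\infty,\infty)$ is the (perturbed) ground energy, $\Delta(v,\rho)=F(\rho)+\langle v,\rho\rangle-E(v)\ge 0$ is the excess energy, and $\mathcal{Z}=\{(v,\rho)\in\mathcal{V}\times\mathcal{D}:\Delta(v,\rho)=0\}$ is the set of ground pairs. $E_0,\Delta_0,\mathcal{Z}_0$ are defined in the same way with $F_0$ in place of $F$ (the reference system). When $E(v^{\odot})$ is finite, $\mathrm{inc}(v^{\odot};\rho,\rho')=\Delta(v^{\odot},\rho)-\Delta(v^{\odot},\rho')$. Lower semiderivative: for $f:X\to\mathbb{R}\cup\{\pm\infty\}$ and $x\in X$ with $f(x)$ finite, $\underline{\mathsf D}f(x)$ is the set of $v\in\mathcal{V}$ such that $\liminf_{s\downarrow0}\frac{f(x+su)-f(x)}{s}\ge\langle v,u\rangle$ for all $u\in X$. *)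

(* Defs.v *)
From HB Require Import structures.
From mathcomp Require Import all_boot all_order all_algebra sesquilinear.
From mathcomp Require Import all_classical all_reals all_analysis.

Set Implicit Arguments.
Unset Strict Implicit.
Unset Printing Implicit Defensive.
Import Order.TTheory GRing.Theory Num.Theory.
Import numFieldNormedType.Exports.

Local Open Scope classical_set_scope.
Local Open Scope ring_scope.
Local Open Scope ereal_scope.

Section LinearAlgebra.
Context {R : realType} {V X : lmodType R}.

(* Finite linear combinations of elements of A. *)
Definition lin_span (A : set X) : set X :=
  [set x | exists (n : nat) (a : 'I_n -> R) (d : 'I_n -> X),
     (forall i, A (d i)) /\ x = (\sum_(i < n) a i *: d i)%R].

(* The pairing separates the points of V and the points of X. *)
Definition nondegenerate_pairing (pair : V -> X -> R) : Prop :=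
  (forall v, (forall x, pair v x = 0%R) -> v = 0%R) /\
  (forall x, (forall v, pair v x = 0%R) -> x = 0%R).

End LinearAlgebra.

(* A function D -> R is represented by a function X -> R of which only the
   values on D are used; ext D f is its extension to X by +oo off D. *)
Section Energies.
Context {R : realType} {V X : lmodType R}.
Variables (pair : V -> X -> R) (D : set X).

Definition ext (f : X -> R) : X -> \bar R := patch (cst +oo) D (EFin \o f).

Definition ground_energy (F : X -> R) (v : V) : \bar R :=
  ereal_inf [set (F rho + pair v rho)%:E | rho in D].

Definition excess (F : X -> R) (v : V) (rho : X) : \bar R :=
  (F rho + pair v rho)%:E - ground_energy F v.

Definition ground_pairs (F : X -> R) : set (V * X) :=
  [set p | D p.2 /\ excess F p.1 p.2 = 0].

Definition inc (F : X -> R) (v : V) (rho rho' : X) : R :=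
  (F rho - F rho' + pair v (rho - rho'))%R.

(* Empty at the points where f is not finite. *)
Definition lower_semiderivative (f : X -> \bar R) (x : X) : set V :=
  [set v | f x \is a fin_num /\ forall u : X,
     (pair v u)%:E <=
       limf_einf (fun s : R => (f (x + s *: u)%R - f x) * (s^-1)%:E) 0^'+].

End Energies.

(* Main.v *)
Require Import Defs.
From HB Require Import structures.
From mathcomp Require Import all_boot all_order all_algebra sesquilinear.
From mathcomp Require Import all_classical all_reals all_analysis.
From mathcomp Require Import ring lra.

(** Convexity of [F] turns the one-sided first-order condition
    [w in lower_semiderivative Phi rho] into a global one: if [rho] is a ground
    state of [F0] at [v], it is a ground state of [F = F0 + Phi] at [v - w].
    Excesses over a known ground state are differences of the functional, so
    the identity is linear algebra, and the bounds say that
    [excess F (vl - wl) rho0] is nonnegative. *)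

Set Implicit Arguments.
Unset Strict Implicit.
Unset Printing Implicit Defensive.
Import Order.TTheory GRing.Theory Num.Theory.
Import numFieldNormedType.Exports.

Local Open Scope classical_set_scope.
Local Open Scope ring_scope.

(** Properness makes each set of the filter meet the set where [f <= c], so the infimum of [f] over
    it is at most [c]. *)
Lemma limf_einf_le (R : realType) (T : choiceType) (X : filteredType T)
    (f : X -> \bar R) (G : set_system X) {GF : ProperFilter G} (c : \bar R) :
  (\forall x \near G, (f x <= c)%E) -> (limf_einf f G <= c)%E.
Proof.
move=> fc; rewrite limf_einfE; apply: ge_ereal_sup => _ [A GA <-].
have [x [Ax fxc]] := filter_ex (filterI GA fc).
by apply: le_trans fxc; apply: ereal_inf_lbound; exists x.
Qed.

Section GroundStates.
Context {R : realType} {V X : lmodType R}.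
Variables (pair : {bilinear V -> X -> R | *%R & *%R}) (D : set X).
Implicit Types (F : X -> R) (v w : V) (rho sigma : X).

(** A zero excess forces the ground energy to be finite, hence equal to [F rho + pair v rho]; this
    moves the computations from extended reals to reals. *)
Lemma excess_ground F v rho sigma : ground_pairs pair D F (v, rho) ->
  excess pair D F v sigma = (inc pair F v sigma rho)%:E.
Proof.
case=> /= _; rewrite /excess; case: (ground_energy _ _ _ _) => //= e.
rewrite -!EFinB => -[] /eqP; rewrite subr_eq0 => /eqP <-.
by rewrite /inc linearBr; congr EFin; ring.
Qed.

Lemma ground_pairsP F v rho : D rho ->
  ground_pairs pair D F (v, rho) <->
  (forall sigma, D sigma -> 0 <= inc pair F v sigma rho).
Proof.
move=> Drho; split=> [gp sigma Dsigma | inc_ge0].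
  rewrite -lee_fin -(excess_ground _ gp) /excess.
  rewrite sube_ge0 ?orbT //; apply: ereal_inf_lbound.
  by exists sigma.
split=> //=; rewrite /excess.
suff -> : ground_energy pair D F v = (F rho + pair v rho)%:E by rewrite subee.
apply/eqP; rewrite eq_le; apply/andP; split.
  by apply: ereal_inf_lbound; exists rho.
apply: le_ereal_inf_tmp => _ [sigma Dsigma <-]; rewrite lee_fin -subr_ge0.
by have := inc_ge0 _ Dsigma; rewrite /inc linearBr; congr (0 <= _); ring.
Qed.

Lemma convex_segment rho sigma s :
  convex_set (M := X) D -> D rho -> D sigma -> 0 <= s <= 1 ->
  D (rho + s *: (sigma - rho)).
Proof.
move=> Dconv Drho Dsigma /andP[s0 s1].
have := Dconv sigma rho (Itv01 s0 s1) (mem_set Dsigma) (mem_set Drho).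
rewrite inE /conv /=; congr D.
by rewrite /unstable.onem scalerBl scale1r scalerBr addrCA.
Qed.

Lemma convex_function_segment F rho sigma s :
  convex_function (E := X) D F -> D rho -> D sigma -> 0 <= s <= 1 ->
  F (rho + s *: (sigma - rho)) - F rho <= s * (F sigma - F rho).
Proof.
move=> Fconv Drho Dsigma /andP[s0 s1].
have := Fconv (Itv01 s0 s1) sigma rho (mem_set Dsigma) (mem_set Drho).
rewrite convRE /= /unstable.onem.
have -> : (conv (Itv01 s0 s1) (sigma : convex_lmodType X) rho) =
    rho + s *: (sigma - rho).
  by rewrite /conv /= /unstable.onem scalerBl scale1r scalerBr addrCA.
move=> h; rewrite lerBlDr; apply: le_trans h _.
by rewrite le_eqVlt; apply/orP; left; apply/eqP; ring.
Qed.

(** Along the segment from [rho] to [sigma], convexity bounds the quotients of [F] above by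
    [F sigma - F rho], and minimality of [rho] bounds those of [F0] below by [- pair v u]. Their
    difference bounds the quotients of [F - F0], hence [pair w u]. *)
Lemma ground_pairs_semiderivative F F0 v w rho :
  convex_set (M := X) D -> convex_function (E := X) D F ->
  ground_pairs pair D F0 (v, rho) ->
  lower_semiderivative pair (ext D (F \- F0)) rho w ->
  ground_pairs pair D F (v - w, rho).
Proof.
move=> Dconv Fconv gp [_ wP]; have Drho : D rho by case: gp.
apply/(ground_pairsP _ _ Drho) => sigma Dsigma.
set u := sigma - rho.
have quotient_le : (pair w u <= F sigma - F rho + pair v u).
  rewrite -lee_fin; apply: le_trans (wP u) _.
  apply: limf_einf_le; near=> s.
  have s_gt0 : 0 < s by near: s; exact: nbhs_right_gt.
  have s01 : 0 <= s <= 1.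
    by rewrite ltW //=; near: s; apply: nbhs_right_le.
  have Ds := convex_segment Dconv Drho Dsigma s01.
  (* Both endpoints of the quotient lie in [D], so [ext] takes finite values there. *)
  rewrite /ext /patch !mem_set //= -EFinB -EFinM lee_fin ler_pdivrMr //.
  have FP := convex_function_segment Fconv Drho Dsigma s01.
  have := (ground_pairsP _ _ Drho).1 gp _ Ds.
  rewrite /inc [rho + _ - rho]addrAC subrr add0r linearZr /= -/u => F0P.
  rewrite -/u in FP.
  lra.
rewrite /inc linearBl /= -/u.
lra.
Unshelve. all: by end_near. Qed.

End GroundStates.

Theorem mainTheorem1 (R : realType) (X V : lmodType R)
    (pair : {bilinear V -> X -> R | *%R & *%R})
    (pair_nondeg : nondegenerate_pairing pair)
    (D : set X) (D_neq0 : D !=set0) (D_convex : convex_set (M := X) D)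
    (D_span : lin_span D = setT)
    (F F0 : X -> R)
    (F_convex : convex_function (E := X) D F)
    (F0_convex : convex_function (E := X) D F0)
    (F_lb : has_lbound (F @` D)) (F0_lb : has_lbound (F0 @` D))
    (Phi := ext D (F \- F0))
    (v v0 w0 : V) (rho0 : X)
    (rho0D : D rho0) (ground0 : ground_pairs pair D F0 (v0, rho0))
    (w0P : lower_semiderivative pair Phi rho0 w0)
    (vhat0 := v0 - w0) (r := v - vhat0)
    (lambda : R) (lambda_gt0 : 0 < lambda) (vl := v0 + lambda *: r)
    (rhol : X) (rholD : D rhol) (groundl : ground_pairs pair D F0 (vl, rhol))
    (wl : V) (wlP : lower_semiderivative pair Phi rhol wl)
    (vhatl := vl - wl) :
  [/\ (inc pair F v rhol rho0)%:E =
        (excess pair D F vhat0 rhol -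
         (lambda^-1)%:E *
           (excess pair D F0 vl rho0 + excess pair D F0 v0 rhol))%E,
      inc pair F v rhol rho0 <=
        lambda^-1 * pair (vl - v0) (rhol - rho0)
        - pair (vhatl - vhat0) (rhol - rho0)
    & inc pair F v rhol rho0 <=
        pair ((1 - lambda) *: r - w0 + wl) (rhol - rho0) ].
Proof.
have gp0 : ground_pairs pair D F (vhat0, rho0).
  exact: ground_pairs_semiderivative D_convex F_convex ground0 w0P.
have gpl : ground_pairs pair D F (vhatl, rhol).
  exact: ground_pairs_semiderivative D_convex F_convex groundl wlP.
have lambda_neq0 : lambda != 0 by rewrite gt_eqF.
(* Comparing [rhol] with [rho0] at [vhatl] gives [inc pair F v rhol rho0 <= pair (v - vhatl) d],
   with [d = rhol - rho0]; both upper bounds are rewritings of this right-hand side. *)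
have := (ground_pairsP _ _ _ rholD).1 gpl _ rho0D.
rewrite (excess_ground _ gp0) (excess_ground _ groundl).
rewrite (excess_ground _ ground0) -[X in (_ * X)%E]EFinD -EFinM -EFinB /inc.
rewrite -(opprB rhol rho0); set d := rhol - rho0.
rewrite /vhatl /vl /vhat0 /r /vhat0.
rewrite !(linearBl, linearDl, linearZl, linearNr) /= => inc_ge0.
split.
(* The [F0] values cancel in the sum of the two reference excesses, leaving
   [- lambda * pair r d]. *)
- by congr EFin; field.
(* Here [a] is [pair v0 d] and [b] is the expanded [pair r d]; cancelling [lambda] makes the goal
   linear. *)
- have -> : forall a b, lambda^-1 * (a + lambda * b - a) = b by move=> a b; field.
  lra.
- lra.
Qed.
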